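(* Let $(M,h,\mathfrak{g}_\varphi,\nabla)$ be a real pseudo-Riemannian calculus over a unital $*$-algebra $\mathcal{A}$, with curvature operator $R$. Then (a) $h(U,R(d_1,d_2)V)=-h(U,R(d_2,d_1)V)$, (b) $h(E_1,R(d_1,d_2)E_2)=-h(E_2,R(d_1,d_2)E_1)$, (c) $R(d_1,d_2)\varphi(d_3)+R(d_2,d_3)\varphi(d_1)+R(d_3,d_1)\varphi(d_2)=0$, (d) $h(\varphi(d_1),R(d_3,d_4)\varphi(d_2))=h(\varphi(d_3),R(d_1,d_2)\varphi(d_4))$, for all $U,V\in M$, $E_1,E_2\in M_\varphi$ and $d_1,d_2,d_3,d_4\in\mathfrak{g}$.
   Context: $\mathcal{A}$ is a unital $*$-algebra over $\mathbb{C}$; $\mathrm{Der}(\mathcal{A})$ is the set of derivations of $\mathcal{A}$ into $\mathcal{A}$. A derivation $d$ is hermitian if $d=d^*$, where $d^*(a)=(d(a^* ))^*$. An element $a\in\mathcal{A}$ is hermitian if $a^*=a$. A hermitian form on a right $\mathcal{A}$-module $M$ is a map $h:M\times M\to\mathcal{A}$ with $h(U,V+W)=h(U,V)+h(U,W)$, $h(U,Va)=h(U,V)a$, $h(U,V)^*=h(V,U)$. It is non-degenerate if $h(U,V)=0$ for all $V\in M$ implies $U=0$. A non-degenerate hermitian form is called a metric, and $(M,h)$ is then a metric $\mathcal{A}$-module. Let $\mathfrak{g}\subseteq\mathrm{Der}(\mathcal{A})$ be a real Lie algebra of hermitian derivations. An affine connection on $(M,\mathfrak{g})$ is a map $\nabla:\mathfrak{g}\times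 M\to M$ with $\nabla_d(U+V)=\nabla_dU+\nabla_dV$, $\nabla_{\lambda d+d'}U=\lambda\nabla_dU+\nabla_{d'}U$, $\nabla_d(Ua)=(\nabla_dU)a+U d(a)$ for all $U,V\in M$, $d,d'\in\mathfrak{g}$, $a\in\mathcal{A}$, $\lambda\in\mathbb{R}$. Real metric calculus: $(M,h)$ is a metric $\mathcal{A}$-module, $\mathfrak{g}\subseteq\mathrm{Der}(\mathcal{A})$ is a real Lie algebra of hermitian derivations, $\varphi:\mathfrak{g}\to M$ is $\mathbb{R}$-linear, and $\mathfrak{g}_\varphi$ denotes the pair $(\mathfrak{g},\varphi)$. The triple $(M,h,\mathfrak{g}_\varphi)$ is a real metric calculus if (1) $M_\varphi=\varphi(\mathfrak{g})$ generates $M$ as an $\mathcal{A}$-module and (2) $h(E,E')^*=h(E,E')$ for all $E,E'\in M_\varphi$. Real connection calculus: a real metric calculus with an affine connection $\nabla$ on $(M,\mathfrak{g})$ such that $h(\nabla_dE,E')$ is hermitian for all $E,E'\in M_\varphi$, $d\in\mathfrak{g}$. A real connection calculus is metric if $d(h(U,V))=h(\nabla_dU,V)+h(U,\nabla_dV)$ for all $d\in\mathfrak{g}$, $U,V\in M$, and torsion-free if $\nabla_{d_1}\varphi(d_2)-\nabla_{d_2}\varphi(d_1)-\varphi([d_1,d_2])=0$ for all $d_1,d_2\in\mathfrak{g}$. A pseudo-Riemannian calculus is a metric and torsion-free real connection calculus. A pseudo-Riemannian calculus is called real if $h(\nabla_{d_1}\nabla_{d_2}E_1,E_2)$ is hermitian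 for all $d_1,d_2\in\mathfrak{g}$ and $E_1,E_2\in M_\varphi$. Its curvature operator is $R(d_1,d_2)U=\nabla_{d_1}\nabla_{d_2}U-\nabla_{d_2}\nabla_{d_1}U-\nabla_{[d_1,d_2]}U$ for $d_1,d_2\in\mathfrak{g}$, $U\in M$. *)

(* Defs.v *)
From HB Require Import structures.
From mathcomp Require Import all_boot all_order all_algebra.
From mathcomp Require Import classical_sets reals complex.

Set Implicit Arguments.
Unset Strict Implicit.
Unset Printing Implicit Defensive.

Import GRing.Theory.

Local Open Scope classical_set_scope.
Local Open Scope ring_scope.
Local Open Scope complex_scope.

HB.mixin Record Algebra_isStar (R : realType) A of GRing.Algebra R[i] A := {
  star : A -> A;
  starK : involutive star;
  starD : {morph star : a b / a + b};
  starZ : forall (c : R[i]) (a : A), star (c *: a) = c^* *: star a;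
  starM : forall a b : A, star (a * b) = star b * star a }.

#[short(type="starAlgType")]
HB.structure Definition StarAlgebra (R : realType) :=
  {A of GRing.Algebra R[i] A & Algebra_isStar R A}.

Section StarAlgebraTheory.
Variables (R : realType) (A : starAlgType R).
Implicit Types (d : A -> A) (a b : A).

Definition hermitian a : Prop := star a = a.

Definition is_derivation d : Prop :=
  linear d /\ forall a b, d (a * b) = d a * b + a * d b.

Definition der_star d : A -> A := fun a => star (d (star a)).

Definition hermitian_der d : Prop := der_star d = d.

Definition der_comb (l : R) d d' : A -> A := fun a => l%:C *: d a + d' a.

Definition der_bracket d d' : A -> A := fun a => d (d' a) - d' (d a).

End StarAlgebraTheory.

Record herm_lie_alg (R : realType) (A : starAlgType R) := HermLieAlg {
  lie_set :> set (A -> A);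
  lie_derivation : forall d, lie_set d -> is_derivation d;
  lie_hermitian : forall d, lie_set d -> hermitian_der d;
  lie_zero : lie_set (fun=> 0);
  lie_comb_closed : forall l d d',
    lie_set d -> lie_set d' -> lie_set (der_comb l d d');
  lie_bracket_closed : forall d d',
    lie_set d -> lie_set d' -> lie_set (der_bracket d d') }.

Section LieOperations.
Variables (R : realType) (A : starAlgType R) (g : herm_lie_alg A).

Definition lie_comb (l : R) (d d' : g) : g :=
  SigSub (mem_set
    (lie_comb_closed l (set_mem (valP d)) (set_mem (valP d')))).

Definition lie_bracket (d d' : g) : g :=
  SigSub (mem_set
    (lie_bracket_closed (set_mem (valP d)) (set_mem (valP d')))).

End LieOperations.

(* A right A-module is a left module over the converse ring A^c. *)
Definition ract (R : realType) (A : starAlgType R) (M : lmodType A^c)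
  (U : M) (a : A) : M := (a : A^c) *: U.

Notation "U <* a" := (ract U a) (at level 40, left associativity) : ring_scope.

Section Calculus.
Variables (R : realType) (A : starAlgType R) (M : lmodType A^c).
Variable h : M -> M -> A.

Record hermitian_form : Prop := HermitianForm {
  hform_addr : forall U V W, h U (V + W) = h U V + h U W;
  hform_actr : forall U V a, h U (V <* a) = h U V * a;
  hform_star : forall U V, star (h U V) = h V U }.

Definition nondegenerate : Prop :=
  forall U, (forall V, h U V = 0) -> U = 0.

Definition metric_form : Prop := hermitian_form /\ nondegenerate.

Variables (g : herm_lie_alg A) (phi : g -> M) (nabla : g -> M -> M).

(* R acts on M through the scalars l%:C *: 1 of A. *)
Definition rscale (l : R) (U : M) : M := U <* (l%:C *: 1).

Definition real_linear : Prop :=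
  forall l d d', phi (lie_comb l d d') = rscale l (phi d) + phi d'.

Definition generates (S : set M) : Prop :=
  forall U, exists (n : nat) (E : 'I_n -> M) (a : 'I_n -> A),
    (forall i, S (E i)) /\ U = \sum_(i < n) E i <* a i.

Record real_metric_calculus : Prop := RealMetricCalculus {
  rmc_metric : metric_form;
  rmc_linear : real_linear;
  rmc_generates : generates (range phi);
  rmc_hermitian : forall E E', range phi E -> range phi E' ->
    hermitian (h E E') }.

Record affine_connection : Prop := AffineConnection {
  conn_add : forall d U V, nabla d (U + V) = nabla d U + nabla d V;
  conn_linear : forall l d d' U,
    nabla (lie_comb l d d') U = rscale l (nabla d U) + nabla d' U;
  conn_leibniz : forall d U a,
    nabla d (U <* a) = nabla d U <* a + U <* val d a }.

Record real_connection_calculus : Prop := RealConnectionCalculus {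
  rcc_rmc : real_metric_calculus;
  rcc_conn : affine_connection;
  rcc_hermitian : forall d E E', range phi E -> range phi E' ->
    hermitian (h (nabla d E) E') }.

Definition metric_connection : Prop :=
  forall (d : g) U V, val d (h U V) = h (nabla d U) V + h U (nabla d V).

Definition torsion_free : Prop :=
  forall d1 d2,
    nabla d1 (phi d2) - nabla d2 (phi d1) - phi (lie_bracket d1 d2) = 0.

Record pseudo_riemannian_calculus : Prop := PseudoRiemannianCalculus {
  prc_rcc : real_connection_calculus;
  prc_metric : metric_connection;
  prc_torsion_free : torsion_free }.

Record real_pseudo_riemannian_calculus : Prop := RealPseudoRiemannianCalculus {
  rprc_prc : pseudo_riemannian_calculus;
  rprc_hermitian : forall d1 d2 E1 E2, range phi E1 -> range phi E2 ->
    hermitian (h (nabla d1 (nabla d2 E1)) E2) }.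

Definition curvature (d1 d2 : g) (U : M) : M :=
  nabla d1 (nabla d2 U) - nabla d2 (nabla d1 U) - nabla (lie_bracket d1 d2) U.

End Calculus.

(* Main.v *)
Require Import Defs.
From mathcomp Require Import all_boot all_order all_algebra.
From mathcomp Require Import boolp classical_sets reals complex.

Local Open Scope classical_set_scope.
Local Open Scope ring_scope.

(** Claim (a) is visible on the definition of the curvature operator, given
    that the bracket is antisymmetric and the connection is additive in the
    derivation.

    For (b), differentiating the form along two derivations and taking the
    commutator shows that a metric connection has skew-adjoint curvature:
    [h (R U) V = - h U (R V)] for all [U] and [V] ([curvature_skew]).  This is
    not yet a symmetry of [h E1 (R E2)] in [E1] and [E2], because
    exchanging the arguments of [h] applies the involution.  The reality conditions on the first and second covariant
    derivatives make [h (R E1) E2] hermitian when [E1] and [E2] lie in the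
    range of [phi] ([curvature_hermitian]), and there the exchange is free.

    For (c), torsion-freeness turns the cyclic sum of curvatures into the
    image under [phi] of a cyclic sum of nested brackets, which vanishes by the
    Jacobi identity ([curvature_bianchi]).

    Finally (d) is a formal consequence of the three other symmetries: an
    algebra-valued function of four arguments that is antisymmetric in its
    first pair and in its last pair and satisfies the Bianchi identity is
    symmetric under exchange of the pairs ([bianchi_pair_symmetry]).  Division
    by two is possible since the algebra is complex. *)

Set Implicit Arguments.
Unset Strict Implicit.
Unset Printing Implicit Defensive.

Import GRing.Theory Num.Theory.

(** * Additive maps and curvature-like tensors *)

Lemma morphD0 (U V : zmodType) (f : U -> V) :
  {morph f : x y / x + y} -> f 0 = 0.
Proof. by move=> fD; apply: (addrI (f 0)); rewrite -fD !addr0. Qed.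

Lemma morphDN (U V : zmodType) (f : U -> V) :
  {morph f : x y / x + y} -> {morph f : x / - x}.
Proof.
by move=> fD x; apply: (addrI (f x)); rewrite -fD !subrr (morphD0 fD).
Qed.

Lemma morphDB (U V : zmodType) (f : U -> V) :
  {morph f : x y / x + y} -> {morph f : x y / x - y}.
Proof. by move=> fD x y; rewrite fD (morphDN fD). Qed.

(** The Jacobi identity for the commutator of additive maps; additivity is what
    lets the outer map act on the two composites of an inner bracket. *)
Lemma jacobi_additive (V : zmodType) (d1 d2 d3 : V -> V) (a : V) :
    {morph d1 : x y / x + y} -> {morph d2 : x y / x + y} ->
    {morph d3 : x y / x + y} ->
  (d1 (d2 (d3 a) - d3 (d2 a)) - (d2 (d3 (d1 a)) - d3 (d2 (d1 a))))
  + (d2 (d3 (d1 a) - d1 (d3 a)) - (d3 (d1 (d2 a)) - d1 (d3 (d2 a))))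
  + (d3 (d1 (d2 a) - d2 (d1 a)) - (d1 (d2 (d3 a)) - d2 (d1 (d3 a)))) = 0.
Proof.
move=> d1D d2D d3D.
rewrite (morphDB d1D) (morphDB d2D) (morphDB d3D) !opprB.
rewrite !addrA.
rewrite (ACl (1*12 * (7*2) * (3*10) * (5*4) * (11*6) * (9*8))) /=.
by rewrite !subrr !addr0.
Qed.

(** Octahedron argument: the four Bianchi identities, one for each index fixed
    in the first slot, express [S a b c d] and [S c d a b] in two ways each,
    through the same four remaining values.  The two expressions of
    the left side and the two of the right side have the same sum, which is the
    claim multiplied by two. *)
Lemma bianchi_pair_symmetry (G : Type) (V : zmodType)
    (S : G -> G -> G -> G -> V) :
    (forall x y : V, x + x = y + y -> x = y) ->
    (forall a b c d, S a b c d = - S b a c d) ->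
    (forall a b c d, S a b c d = - S a b d c) ->
    (forall a b c d, S a b c d + S a c d b + S a d b c = 0) ->
  forall a b c d, S a b c d = S c d a b.
Proof.
move=> inj2 SN12 SN34 bianchi a b c d; apply: inj2.
have SNN i j k l : S i j k l = S j i l k by rewrite SN12 SN34 opprK.
have face i j k l : S i j k l = - (S i k l j + S i l j k).
  by apply/eqP; rewrite -addr_eq0 addrA bianchi.
have face_a := face a b c d.
have face_b : S a b c d = - (S d b a c + S b c a d).
  by rewrite SNN face (SNN b d).
have face_c : S c d a b = - (S a c d b + S b c a d).
  by rewrite face (SNN c a) (SNN c b).
have face_d : S c d a b = - (S d b a c + S a d b c).
  by rewrite SNN face (SNN d a).
rewrite {1}face_a face_b {1}face_c face_d -!opprD; congr (- _).
by rewrite !addrA (ACl (1*4*3*2)).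
Qed.

(** A complex algebra has no 2-torsion, because 2 is invertible in the
    scalars. *)
Lemma addxx_inj (R : realType) (A : starAlgType R) (x y : A) :
  x + x = y + y -> x = y.
Proof.
have halfD (z : A) : (2%:R^-1 : R[i]) *: (z + z) = z.
  have half2 : (2%:R^-1 : R[i]) + 2%:R^-1 = 1.
    by rewrite -[LHS]mulr2n -[LHS]mulr_natr mulVf ?pnatr_eq0.
  by rewrite scalerDr -scalerDl half2 scale1r.
by move=> xy; rewrite -(halfD x) xy halfD.
Qed.

(** * The real Lie algebra and its images *)

Lemma rscale1 (R : realType) (A : starAlgType R) (M : lmodType A^c) (U : M) :
  rscale 1 U = U.
Proof. by rewrite /rscale scale1r /ract scale1r. Qed.

Section LieAlgebra.
Variables (R : realType) (A : starAlgType R) (g : herm_lie_alg A).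
Implicit Types d : g.

Lemma lie_der_add d : {morph val d : a b / a + b}.
Proof.
have [lin _] := lie_derivation (set_mem (valP d)).
by move=> a b; rewrite -[a in LHS]scale1r lin scale1r.
Qed.

Definition lie_null : g := SigSub (mem_set (lie_zero g)).

Lemma lie_comb_null d : lie_comb 1 lie_null d = d.
Proof.
by apply/val_inj/funext => a; rewrite /= /der_comb scaler0 add0r.
Qed.

Lemma lie_bracket_anti d1 d2 :
  lie_comb 1 (lie_bracket d1 d2) (lie_bracket d2 d1) = lie_null.
Proof.
apply/val_inj/funext => a.
by rewrite /= /der_comb /der_bracket scale1r -opprB addNr.
Qed.

Lemma lie_jacobi d1 d2 d3 :
  lie_comb 1 (lie_comb 1 (lie_bracket d1 (lie_bracket d2 d3))
                         (lie_bracket d2 (lie_bracket d3 d1)))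
             (lie_bracket d3 (lie_bracket d1 d2)) = lie_null.
Proof.
apply/val_inj/funext => a; rewrite /= /der_comb /der_bracket /= !scale1r.
by apply: jacobi_additive; apply: lie_der_add.
Qed.

(** Identities between brackets are transported to a module along an additive
    map, in practice [phi] or [nabla] at a fixed vector.  The sum of [d] and
    [d'] is written [lie_comb 1 d d']. *)
Section LieAdditive.
Variables (V : zmodType) (f : g -> V).
Hypothesis fD : forall d d', f (lie_comb 1 d d') = f d + f d'.

Lemma lie_additive_null : f lie_null = 0.
Proof. by apply: (addIr (f lie_null)); rewrite -fD lie_comb_null add0r. Qed.

Lemma lie_additive_anti d1 d2 :
  f (lie_bracket d1 d2) = - f (lie_bracket d2 d1).
Proof.
by apply/eqP; rewrite -addr_eq0 -fD lie_bracket_anti lie_additive_null.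
Qed.

Lemma lie_additive_jacobi d1 d2 d3 :
  f (lie_bracket d1 (lie_bracket d2 d3))
  + f (lie_bracket d2 (lie_bracket d3 d1))
  + f (lie_bracket d3 (lie_bracket d1 d2)) = 0.
Proof. by rewrite -!fD lie_jacobi lie_additive_null. Qed.

End LieAdditive.
End LieAlgebra.

(** * Curvature *)

Section Curvature.
Variables (R : realType) (A : starAlgType R) (M : lmodType A^c).
Variables (h : M -> M -> A) (g : herm_lie_alg A).
Variables (phi : g -> M) (nabla : g -> M -> M).

Lemma hform_addl : hermitian_form h ->
  forall V, {morph h^~ V : U W / U + W}.
Proof.
by move=> hh V U W; rewrite -!(hform_star hh V) hform_addr // starD.
Qed.

Lemma curvature_anti d1 d2 V : affine_connection nabla ->
  curvature nabla d1 d2 V = - curvature nabla d2 d1 V.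
Proof.
move=> conn; rewrite /curvature opprB opprB.
have nablaD d d' : nabla (lie_comb 1 d d') V = nabla d V + nabla d' V.
  by rewrite conn_linear // rscale1.
by rewrite (lie_additive_anti nablaD) opprK addrC.
Qed.

(** Differentiating [h U V] twice, the mixed terms [h (nabla d1 U) (nabla d2 V)]
    are symmetric in the two derivations, so the commutator of derivatives acts
    on [h U V] by the Leibniz rule with the commutator of the covariant
    derivatives; on the other side, the bracket is again in the Lie algebra and
    the connection along it is metric as well. *)
Lemma curvature_skew d1 d2 U V :
    hermitian_form h -> metric_connection h nabla ->
  h (curvature nabla d1 d2 U) V = - h U (curvature nabla d1 d2 V).
Proof.
move=> hh hm.
have hDl W : {morph h^~ W : x y / x + y} by apply: hform_addl.
have hDr W : {morph h W : x y / x + y} by apply: hform_addr.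
have second d d' : val d (val d' (h U V)) =
    h (nabla d (nabla d' U)) V + h (nabla d' U) (nabla d V)
    + (h (nabla d U) (nabla d' V) + h U (nabla d (nabla d' V))).
  by rewrite hm lie_der_add !hm.
have := hm (lie_bracket d1 d2) U V.
rewrite [LHS]/= /der_bracket !second => eq12.
apply/eqP; rewrite -addr_eq0 /curvature.
rewrite !(morphDB (hDl V)) !(morphDB (hDr U)).
(* The mixed first-order terms cancel between the two orders. *)
rewrite addrACA -opprD -eq12 subr_eq0 eq_sym !opprD !addrA; apply/eqP.
by rewrite [LHS](ACl (1*5*4*8*(2*7)*(3*6))) /= !subrr !addr0.
Qed.

(** Each of the three terms of [h (R E1) E2] is hermitian by an assumption: the
    two second-order terms because the calculus is real, the bracket term
    because it is a first covariant derivative. *)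
Lemma curvature_hermitian d1 d2 E1 E2 :
    real_pseudo_riemannian_calculus h phi nabla ->
    range phi E1 -> range phi E2 ->
  h (curvature nabla d1 d2 E1) E2 = h E2 (curvature nabla d1 d2 E1).
Proof.
move=> [[[[[hh _] _ _ _] _ first_herm] _ _] second_herm] rE1 rE2.
rewrite -[RHS](hform_star hh) /curvature.
rewrite !(morphDB (hform_addl hh E2)).
rewrite !(morphDB (@starD R A)).
by rewrite !second_herm // first_herm.
Qed.

(** By torsion-freeness the second covariant derivatives combine into
    covariant derivatives of brackets, and then into nested brackets, so the
    cyclic sum is the image under [phi] of the Jacobi identity. *)
Lemma curvature_bianchi d1 d2 d3 :
    real_linear phi -> affine_connection nabla -> torsion_free phi nabla ->
  curvature nabla d1 d2 (phi d3) + curvature nabla d2 d3 (phi d1)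
    + curvature nabla d3 d1 (phi d2) = 0.
Proof.
move=> phi_lin conn tf.
have phiD d d' : phi (lie_comb 1 d d') = phi d + phi d'.
  by rewrite phi_lin rscale1.
have nablaB d : {morph nabla d : U V / U - V}.
  by apply: morphDB; apply: conn_add.
have torsion d d' : nabla d (phi d') - nabla d' (phi d) = phi (lie_bracket d d').
  by apply/eqP; rewrite -subr_eq0 tf.
have nested d d' d'' : nabla d (nabla d' (phi d'')) - nabla d (nabla d'' (phi d'))
    - nabla (lie_bracket d' d'') (phi d) = phi (lie_bracket d (lie_bracket d' d'')).
  by rewrite -nablaB torsion torsion.
rewrite -(lie_additive_jacobi phiD d1 d2 d3) -!nested /curvature.
rewrite !addrA.
(* The subtracted second derivative of each curvature is matched with the
   positive one, along the same derivation, of another curvature. *)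
by rewrite [LHS](ACl (1*8*6*4*2*9*7*5*3)).
Qed.

End Curvature.

Theorem proposition4p5 (R : realType) (A : starAlgType R) (M : lmodType A^c)
  (h : M -> M -> A) (g : herm_lie_alg A) (phi : g -> M) (nabla : g -> M -> M)
  (calc : real_pseudo_riemannian_calculus h phi nabla) :
  [/\ forall (U V : M) (d1 d2 : g),
        h U (curvature nabla d1 d2 V) = - h U (curvature nabla d2 d1 V),
      forall (E1 E2 : M) (d1 d2 : g), range phi E1 -> range phi E2 ->
        h E1 (curvature nabla d1 d2 E2) = - h E2 (curvature nabla d1 d2 E1),
      forall d1 d2 d3 : g,
        curvature nabla d1 d2 (phi d3) + curvature nabla d2 d3 (phi d1)
          + curvature nabla d3 d1 (phi d2) = 0
    & forall d1 d2 d3 d4 : g,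
        h (phi d1) (curvature nabla d3 d4 (phi d2))
          = h (phi d3) (curvature nabla d1 d2 (phi d4))].
Proof.
have [[[[[hh _] phi_lin _ _] conn _] metric tf] _] := calc.
have hN U : {morph h U : V / - V} by apply: morphDN; apply: hform_addr.
have anti U V d1 d2 :
    h U (curvature nabla d1 d2 V) = - h U (curvature nabla d2 d1 V).
  by rewrite (curvature_anti d1 d2) // hN.
have skew E1 E2 d1 d2 : range phi E1 -> range phi E2 ->
    h E1 (curvature nabla d1 d2 E2) = - h E2 (curvature nabla d1 d2 E1).
  move=> rE1 rE2; rewrite -(curvature_hermitian _ _ calc) //.
  by rewrite curvature_skew ?opprK.
have bianchi d1 d2 d3 : curvature nabla d1 d2 (phi d3)
    + curvature nabla d2 d3 (phi d1) + curvature nabla d3 d1 (phi d2) = 0.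
  exact: curvature_bianchi.
split=> // d1 d2 d3 d4.
pose S a b c d := h (phi a) (curvature nabla c d (phi b)).
apply: (@bianchi_pair_symmetry _ _ S) => [x y|a b c d|a b c d|a b c d].
- exact: addxx_inj.
- by apply: skew; apply: imageT.
- exact: anti.
- by rewrite /S -!(hform_addr hh) bianchi (morphD0 (hform_addr hh _)).
Qed.
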